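(* Consider the quadrotor rotational subsystem (after the inner feedback loop) with state $\mathbf{x}=(x_1,\dots,x_6)^T=(\phi,\dot\phi,\theta,\dot\theta,\psi,\dot\psi)^T$: $$\begin{aligned} \dot x_1&=x_2,\\ \dot x_2&=a_1x_4x_6-a_2x_4\,g(\mathbf{u})-b_1k_p^\phi(x_1-x_1^d)+b_1v_1,\\ \dot x_3&=x_4,\\ \dot x_4&=a_3x_2x_6+a_4x_2\,g(\mathbf{u})-b_2k_p^\theta(x_3-x_3^d)+b_2v_2,\\ \dot x_5&=x_6,\\ \dot x_6&=a_5x_2x_4-b_3k_p^\psi(x_5-x_5^d)+b_3v_3, \end{aligned}$$ with input $\bm{v}=(v_1,v_2,v_3)^T$ and output $\bm{\eta}=(\phi,\theta,\psi)^T=(x_1,x_3,x_5)^T$, where the desired reference signal $\bm{\eta}_d=(x_1^d,x_3^d,x_5^d)^T$ is set to $(0,0,0)^T$. Then this system is a nonlinear negative imaginary system with respect to the positive definite storage function $$V=\tfrac12\,\dot{\bm{\eta}}^T\mathbf{J}(\bm{\eta})\,\dot{\bm{\eta}}+\tfrac12(\bm{\eta}-\bm{\eta}_d)^T\mathbf{K}_p(\bm{\eta}-\bm{\eta}_d),$$ where $\mathbf{J}$ is the (positive definite) rotational inertia matrix and $\mathbf{K}_p=\operatorname{diag}(k_p^\phi,k_p^\theta,k_p^\psi)$ is a positive diagonal matrix.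
   Context: The angles $\phi,\theta,\psi$ are the roll, pitch and yaw angles of the quadrotor. The rotational inertia matrix is defined in the body frame as $\mathbf{J}=\operatorname{diag}(J_x,J_y,J_z)$, with $J_x,J_y,J_z$ the roll, pitch and yaw inertias. Constants: $a_1=(J_y-J_z)/J_x$, $a_2=J_r/J_x$, $a_3=(J_z-J_x)/J_y$, $a_4=J_r/J_y$, $a_5=(J_x-J_y)/J_z$, $b_1=l/J_x$, $b_2=l/J_y$, $b_3=1/J_z$, where $l$ is the arm length (distance from the axis of rotation of the rotors to the center of the quadrotor) and $J_r$ is a constant (the rotor inertia). The vector $\mathbf{u}=(u_1,u_2,u_3,u_4)^T$ is the quadrotor input: $u_1$ is the thrust, and $(u_2,u_3,u_4)^T$ is the torque input, given by the inner feedback law $(u_2,u_3,u_4)^T=-\mathbf{K}_p(\bm{\eta}-\bm{\eta}_d)+\bm{v}$. The term $g(\mathbf{u})$ is a scalar function of the input appearing in the gyroscopic terms of the model; nothing further is specified about it. Nonlinear negative imaginary (NI): a system $\dot{\mathbf{x}}=\mathbf{f}(\mathbf{x},\mathbf{u})$, $\mathbf{y}=\mathbf{h}(\mathbf{x})$, with $\mathbf{f}:\mathbb{R}^n\times\mathbb{R}^m\to\mathbb{R}^n$ Lipschitz continuous and $\mathbf{h}:\mathbb{R}^n\to\mathbb{R}^m$ continuously differentiable, is called nonlinear negative imaginary if there exists a non-negative function $V:\mathbb{R}^n\to\mathbb{R}$ of class $C^1$ (called the storage function) such that $\dot V(\mathbf{x}(t))\le\dot{\mathbf{y}}(t)^T\mathbf{u}(t)$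 for all $t\ge0$. In the claim the input in this definition is $\bm{v}$ and the output is $\bm{\eta}$.
   Formalization: The arm length is taken to be l = 1 (for l ≠ 1 the dissipation inequality with this V fails), and ''Lipschitz continuous'' is read as locally Lipschitz (the quadratic terms are not globally Lipschitz), with g(u) assumed locally Lipschitz. *)

(* Defs.v *)
From HB Require Import structures.
From mathcomp Require Import all_boot all_order all_algebra.
From mathcomp Require Import all_classical all_reals all_analysis.
Set Implicit Arguments.
Unset Strict Implicit.
Unset Printing Implicit Defensive.
Import Order.TTheory GRing.Theory Num.Theory.
Import numFieldNormedType.Exports.
Local Open Scope classical_set_scope.
Local Open Scope ring_scope.

(* Systems with quadratic terms are not globally Lipschitz, so Lipschitz
   continuity of a vector field is understood locally, as usual for ODEs. *)
Definition locally_lipschitz (R : realType) (U W : normedModType R)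
    (f : U -> W) : Prop :=
  forall x : U, exists2 A : set U, nbhs x A & [lipschitz f y | y in A].

(* When U is finite-dimensional, continuity of all the directional derivatives
   is continuity of the differential. *)
Definition class_C1 (R : realType) (U W : normedModType R) (f : U -> W) : Prop :=
  (forall x : U, differentiable f x) /\
  (forall v : U, continuous (fun x : U => 'D_v f x)).

Definition positive_definite (R : realType) (n : nat)
    (V : 'cV[R]_n -> R) : Prop :=
  V 0 = 0 /\ forall x : 'cV[R]_n, x != 0 -> 0 < V x.

(* The vector field f x u w depends on the state x, on the input u and on a
   further signal w with values in W that takes no part in the supply rate.
   The plain notion for dx/dt = f(x, u) is the case where f ignores w. *)
Section NegativeImaginary.
Variables (R : realType) (n m : nat) (W : normedModType R).
Variables (f : 'cV[R]_n -> 'cV[R]_m -> W -> 'cV[R]_n) (h : 'cV[R]_n -> 'cV[R]_m).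

(* Derivatives are two-sided also at t = 0: a solution on [0, +oo[ with a
   one-sided derivative at 0 extends to the line, linearly on ]-oo, 0[. *)
Definition trajectory (x : R -> 'cV[R]_n) (u : R -> 'cV[R]_m) (w : R -> W) :
    Prop :=
  forall t : R, 0 <= t -> is_derive t 1 x (f (x t) (u t) (w t)).

Definition storage_function (V : 'cV[R]_n -> R) : Prop :=
  [/\ class_C1 V,
      forall x : 'cV[R]_n, 0 <= V x
    & forall (x : R -> 'cV[R]_n) (u : R -> 'cV[R]_m) (w : R -> W),
        trajectory x u w -> forall t : R, 0 <= t ->
        derive1 (V \o x) t <= ((derive1 (h \o x) t)^T *m u t) 0 0].

Definition nonlinear_negative_imaginary : Prop :=
  [/\ locally_lipschitz
        (fun z : 'cV[R]_n * 'cV[R]_m * W => f z.1.1 z.1.2 z.2),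
      class_C1 h
    & exists V : 'cV[R]_n -> R, storage_function V].

End NegativeImaginary.

(* Jr is the inertia of the rotors. The arm length enters the equations of roll
   and pitch but not that of yaw, so that u2 and u3 are forces and u4 a torque.
   Adding the three terms of v^T dot(eta), or of the quadratic form of the gains
   in quadrotor_storage, hence takes the arm as the unit of length: along
   trajectories (with etad = 0), dot V - v^T dot(eta) is
     (1 - arm) * (x2 * (kphi * x1 - v1) + x4 * (ktheta * x3 - v2)),
   which has no sign unless arm = 1. *)
Record quadrotor (R : realType) := Quadrotor {
  Jx : R; Jy : R; Jz : R;
  Jr : R;
  arm : R;
  kphi : R; ktheta : R; kpsi : R
}.

Section Quadrotor.
Variables (R : realType) (q : quadrotor R).

Definition a1 : R := (Jy q - Jz q) / Jx q.
Definition a2 : R := Jr q / Jx q.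
Definition a3 : R := (Jz q - Jx q) / Jy q.
Definition a4 : R := Jr q / Jy q.
Definition a5 : R := (Jx q - Jy q) / Jz q.
Definition b1 : R := arm q / Jx q.
Definition b2 : R := arm q / Jy q.
Definition b3 : R := 1 / Jz q.

Definition vec3 (a b c : R) : 'cV[R]_3 := \col_(i < 3) nth 0 [:: a; b; c] i.

Definition inertia : 'M[R]_3 := diag_mx (vec3 (Jx q) (Jy q) (Jz q))^T.
Definition gain : 'M[R]_3 := diag_mx (vec3 (kphi q) (ktheta q) (kpsi q))^T.

(* The state (phi, dphi, theta, dtheta, psi, dpsi) has indices 0, ..., 5. *)
Definition attitude (x : 'cV[R]_6) : 'cV[R]_3 :=
  vec3 (x (inord 0) 0) (x (inord 2) 0) (x (inord 4) 0).
Definition attitude_rate (x : 'cV[R]_6) : 'cV[R]_3 :=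
  vec3 (x (inord 1) 0) (x (inord 3) 0) (x (inord 5) 0).

(* u = (u1, u2, u3, u4), where (u2, u3, u4) is the inner feedback law. *)
Definition quadrotor_input (etad : 'cV[R]_3) (x : 'cV[R]_6) (v : 'cV[R]_3)
    (u1 : R) : 'cV[R]_(1 + 3) :=
  col_mx u1%:M (- (gain *m (attitude x - etad)) + v).

Definition rotational_dynamics (g : 'cV[R]_4 -> R) (etad : 'cV[R]_3)
    (x : 'cV[R]_6) (v : 'cV[R]_3) (u1 : R) : 'cV[R]_6 :=
  let x1 := x (inord 0) 0 in let x2 := x (inord 1) 0 in
  let x3 := x (inord 2) 0 in let x4 := x (inord 3) 0 in
  let x5 := x (inord 4) 0 in let x6 := x (inord 5) 0 in
  let x1d := etad (inord 0) 0 in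
  let x3d := etad (inord 1) 0 in
  let x5d := etad (inord 2) 0 in
  let v1 := v (inord 0) 0 in
  let v2 := v (inord 1) 0 in
  let v3 := v (inord 2) 0 in
  let gu := g (quadrotor_input etad x v u1) in
  \col_(i < 6) nth 0
    [:: x2;
        a1 * x4 * x6 - a2 * x4 * gu - b1 * kphi q * (x1 - x1d) + b1 * v1;
        x4;
        a3 * x2 * x6 + a4 * x2 * gu - b2 * ktheta q * (x3 - x3d) + b2 * v2;
        x6;
        a5 * x2 * x4 - b3 * kpsi q * (x5 - x5d) + b3 * v3] i.

Definition quadrotor_storage (etad : 'cV[R]_3) (x : 'cV[R]_6) : R :=
  2^-1 * ((attitude_rate x)^T *m inertia *m attitude_rate x) 0 0 +
  2^-1 * ((attitude x - etad)^T *m gain *m (attitude x - etad)) 0 0.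

End Quadrotor.

(* Main.v *)
(* With etad = 0 the storage function is half a sum of weighted squares of the
   state coordinates, the weights being the inertias and the gains.  Along a
   trajectory, the two gyroscopic terms in g(u) have opposite contributions to
   its derivative, the coefficients of x2 * x4 * x6 add up to
   (Jy - Jz) + (Jz - Jx) + (Jx - Jy) = 0, and the inner feedback cancels the
   derivative of the potential part.  What remains is exactly v^T dot(eta), so
   the dissipation inequality is an equality. *)
Require Import Defs.
From HB Require Import structures.
From mathcomp Require Import all_boot all_order all_algebra.
From mathcomp Require Import all_classical all_reals all_analysis.
From mathcomp Require Import ring.
Set Implicit Arguments.
Unset Strict Implicit.
Unset Printing Implicit Defensive.
Import Order.TTheory GRing.Theory Num.Theory.
Import numFieldNormedType.Exports.
Local Open Scope classical_set_scope.
Local Open Scope ring_scope.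

(** * Locally Lipschitz maps and their closure properties *)

Lemma ler_entry_norm (R : realType) (m n : nat) (M : 'M[R]_(m, n)) i j :
  `|M i j| <= `|M|.
Proof.
rewrite [leRHS]/Num.Def.normr /= mx_normrE.
by apply/bigmax_geP; right; exists (i, j).
Qed.

Section LocallyLipschitz.
Variables (R : realType) (U : normedModType R).

(** The library notion quantifies over all constants near infinity. An explicit nonnegative constant
    on a neighbourhood is easier to add and multiply. *)
Lemma locally_lipschitzP (W : normedModType R) (f : U -> W) :
  locally_lipschitz f <->
  forall x : U, exists (A : set U) (k : R), [/\ nbhs x A, 0 <= k &
    forall y z, A y -> A z -> `|f y - f z| <= k * `|y - z|].
Proof.
split=> fL x.
  have [A Ax [M [_ fA]]] := fL x.
  (* This constant is nonnegative and lies strictly above the threshold [M]. *)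
  exists A, (Num.max 0 M + 1); split=> // [|y z Ay Az].
    by rewrite addr_ge0 // le_max lexx.
  by apply: (fA _ _ (y, z)) => //=; rewrite ltr_pwDr // le_max lexx orbT.
have [A [k [Ax k0 fA]]] := fL x.
exists A => //; apply: (@klipschitzW _ _ _ k).
  (* [klipschitzW] needs a proper filter: the product of [A] with itself is inhabited by
     [(x, x)]. *)
  have Axx := nbhs_singleton Ax.
  exact: (@globally_properfilter _ _ (x, x) (conj Axx Axx)).
by move=> [y z] [/= Ay Az]; exact: fA.
Qed.

Lemma eq_locally_lipschitz (W : normedModType R) (f g : U -> W) :
  g =1 f -> locally_lipschitz f -> locally_lipschitz g.
Proof. by move=> /funext ->. Qed.

Lemma locally_lipschitz_continuous (W : normedModType R) (f : U -> W) :
  locally_lipschitz f -> continuous f.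
Proof.
move=> /locally_lipschitzP fL x; have [A [k [Ax k0 fA]]] := fL x.
apply/cvgrPdist_lt => e e0; near=> y.
have Ay : A y by near: y.
apply: le_lt_trans (fA _ _ (nbhs_singleton Ax) Ay) _.
(* Since [k] may be 0, [k + 1] is used in order to divide by a positive number. *)
apply: (@le_lt_trans _ _ ((k + 1) * `|x - y|)).
  by rewrite ler_wpM2r // lerDl.
rewrite mulrC -ltr_pdivlMr ?ltr_wpDl //.
near: y; apply: cvgr_dist_lt; first exact: cvg_id.
by rewrite divr_gt0 // ltr_wpDl.
Unshelve. all: by end_near. Qed.

Lemma lipschitz_locally_lipschitz (W : normedModType R) (f : U -> W) (k : R) :
  0 <= k -> (forall y z, `|f y - f z| <= k * `|y - z|) -> locally_lipschitz f.
Proof.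
move=> k0 fk; apply/locally_lipschitzP => x.
by exists setT, k; split=> //; exact: filterT.
Qed.

Lemma locally_lipschitz_cst (W : normedModType R) (w : W) :
  locally_lipschitz (fun _ : U => w).
Proof.
apply: (lipschitz_locally_lipschitz (k := 0)) => // y z.
by rewrite subrr normr0 mul0r.
Qed.

Lemma locally_lipschitzD (W : normedModType R) (f g : U -> W) :
  locally_lipschitz f -> locally_lipschitz g ->
  locally_lipschitz (fun x => f x + g x).
Proof.
move=> /locally_lipschitzP fL /locally_lipschitzP gL.
apply/locally_lipschitzP => x.
have [A [k [Ax k0 fA]]] := fL x; have [B [l [Bx l0 gB]]] := gL x.
exists (A `&` B), (k + l); split=> [||y z [Ay By] [Az Bz]].
- exact: filterI.
- exact: addr_ge0.
rewrite opprD addrACA mulrDl (le_trans (ler_normD _ _)) // lerD //.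
- exact: fA.
- exact: gB.
Qed.

Lemma locally_lipschitz_sum (W : normedModType R) (n : nat)
    (f : 'I_n -> U -> W) :
  (forall i, locally_lipschitz (f i)) ->
  locally_lipschitz (fun x => \sum_i f i x).
Proof.
move=> fL; elim: n f fL => [|n IH] f fL.
  rewrite (_ : (fun _ => _) = fun _ => 0); first exact: locally_lipschitz_cst.
  by apply/funext => x; rewrite big_ord0.
under eq_fun do rewrite big_ord_recl.
by apply: locally_lipschitzD => //; apply: IH => i; exact: fL.
Qed.

(** A product is Lipschitz where both factors are Lipschitz and bounded. Continuity provides the
    bounds near each point. *)
Lemma locally_lipschitzZ (W : normedModType R) (k : U -> R) (f : U -> W) :
  locally_lipschitz k -> locally_lipschitz f ->
  locally_lipschitz (fun x => k x *: f x).
Proof.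
move=> kL fL.
have kC := locally_lipschitz_continuous kL.
have fC := locally_lipschitz_continuous fL.
move: kL fL => /locally_lipschitzP kL /locally_lipschitzP fL.
apply/locally_lipschitzP => x.
have [A [a [Ax a0 kA]]] := kL x; have [B [b [Bx b0 fB]]] := fL x.
(* On [C] each factor exceeds its norm at [x] by at most 1; these bounds give the Lipschitz constant
   below. *)
pose C := [set y | `|k y| <= `|k x| + 1 /\ `|f y| <= `|f x| + 1].
have Cx : nbhs x C.
  near=> y; split.
    have : `|k x - k y| < 1 by near: y; apply: cvgr_dist_lt (kC x) _ ltr01.
    rewrite distrC => /ltW kxy; rewrite -[k y](subrK (k x)) addrC.
    by rewrite (le_trans (ler_normD _ _)) // lerD2l.
  have : `|f x - f y| < 1 by near: y; apply: cvgr_dist_lt (fC x) _ ltr01.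
  rewrite distrC => /ltW fxy; rewrite -[f y](subrK (f x)) addrC.
  by rewrite (le_trans (ler_normD _ _)) // lerD2l.
exists (A `&` B `&` C), ((`|k x| + 1) * b + (`|f x| + 1) * a).
split=> [||y z [[Ay By] [ky fy]] [[Az Bz] [kz fz]]].
- by do 2!apply: filterI => //.
- by rewrite addr_ge0 // mulr_ge0 // addr_ge0.
have -> : k y *: f y - k z *: f z = k y *: (f y - f z) + (k y - k z) *: f z.
  by rewrite scalerBr scalerBl addrA subrK.
rewrite (le_trans (ler_normD _ _)) // !normrZ mulrDl lerD //.
- by rewrite -mulrA ler_pM // fB.
- by rewrite mulrC -mulrA ler_pM // kA.
Unshelve. all: by end_near. Qed.

Lemma locally_lipschitzM (f g : U -> R) :
  locally_lipschitz f -> locally_lipschitz g ->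
  locally_lipschitz (fun x => f x * g x).
Proof. exact: locally_lipschitzZ. Qed.

Lemma locally_lipschitzB (f g : U -> R) :
  locally_lipschitz f -> locally_lipschitz g ->
  locally_lipschitz (fun x => f x - g x).
Proof.
move=> fL gL; apply: locally_lipschitzD => //.
under eq_fun do rewrite -mulN1r.
by apply: locally_lipschitzM => //; exact: locally_lipschitz_cst.
Qed.

(** A matrix is a finite combination of the constant matrices [delta_mx i j], so closure under sums
    and scaling suffices. *)
Lemma locally_lipschitz_mx (m n : nat) (f : U -> 'M[R]_(m, n)) :
  (forall i j, locally_lipschitz (fun x => f x i j)) -> locally_lipschitz f.
Proof.
move=> fL; rewrite (_ : f = fun x => \sum_i \sum_j f x i j *: delta_mx i j).
  apply: locally_lipschitz_sum => i; apply: locally_lipschitz_sum => j.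
  by apply: locally_lipschitzZ => //; exact: locally_lipschitz_cst.
by apply/funext => x; exact: matrix_sum_delta.
Qed.

End LocallyLipschitz.

Lemma locally_lipschitz_comp (R : realType) (U V W : normedModType R)
    (f : V -> W) (g : U -> V) :
  locally_lipschitz f -> locally_lipschitz g ->
  locally_lipschitz (fun x => f (g x)).
Proof.
move=> fL gL; have gC := locally_lipschitz_continuous gL.
move: fL gL => /locally_lipschitzP fL /locally_lipschitzP gL.
apply/locally_lipschitzP => x.
have [A [k [Ax k0 gA]]] := gL x; have [B [l [Bx l0 fB]]] := fL (g x).
exists (A `&` g @^-1` B), (l * k); split=> [||y z [Ay By] [Az Bz]].
- by apply: filterI => //; exact: gC.
- exact: mulr_ge0.
by rewrite (le_trans (fB _ _ By Bz)) // -mulrA ler_wpM2l // gA.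
Qed.

(** Taking an entry is 1-Lipschitz for the max norm. *)
Lemma locally_lipschitz_entry (R : realType) (U : normedModType R)
    (m n : nat) (f : U -> 'M[R]_(m, n)) i j :
  locally_lipschitz f -> locally_lipschitz (fun x => f x i j).
Proof.
apply: (locally_lipschitz_comp (f := fun M : 'M[R]_(m, n) => M i j)).
apply: (lipschitz_locally_lipschitz (k := 1)) => // M N.
by have := ler_entry_norm (M - N) i j; rewrite !mxE mul1r.
Qed.

(** * Maps of class C1 and their closure properties *)

Section ClassC1.
Variables (R : realType) (U : normedModType R).

Lemma class_C1_cst (W : normedModType R) (w : W) : class_C1 (fun _ : U => w).
Proof.
split=> [x|v x]; first exact: differentiable_cst.
under eq_fun do rewrite derive_cst.
exact: cst_continuous.
Qed.

Lemma class_C1D (W : normedModType R) (f g : U -> W) :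
  class_C1 f -> class_C1 g -> class_C1 (fun x => f x + g x).
Proof.
move=> [fd fC] [gd gC]; split=> [x|v]; first exact: differentiableD.
rewrite (_ : (fun _ => _) = fun x => 'D_v f x + 'D_v g x).
  by move=> x; apply: cvgD; [exact: fC|exact: gC].
by apply/funext => x; rewrite -deriveD //; exact: diff_derivable.
Qed.

Lemma class_C1_sum (W : normedModType R) (n : nat) (f : 'I_n -> U -> W) :
  (forall i, class_C1 (f i)) -> class_C1 (fun x => \sum_i f i x).
Proof.
move=> fC; elim: n f fC => [|n IH] f fC.
  rewrite (_ : (fun _ => _) = fun _ => 0); first exact: class_C1_cst.
  by apply/funext => x; rewrite big_ord0.
under eq_fun do rewrite big_ord_recl.
by apply: class_C1D => //; apply: IH => i; exact: fC.
Qed.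

(** A fixed vector [w] is enough here: the use is the expansion of a matrix along [delta_mx i j]. *)
Lemma class_C1Zl (W : normedModType R) (k : U -> R) (w : W) :
  class_C1 k -> class_C1 (fun x => k x *: w).
Proof.
move=> [kd kC]; split=> [x|v]; first exact: differentiableZl.
rewrite (_ : (fun _ => _) = fun x => 'D_v k x *: w).
  by move=> x; apply: cvgZr_tmp; exact: kC.
apply/funext => x; rewrite !deriveE //; last exact: differentiableZl.
by rewrite diffZl.
Qed.

Lemma class_C1M (f g : U -> R) :
  class_C1 f -> class_C1 g -> class_C1 (fun x => f x * g x).
Proof.
move=> [fd fC] [gd gC]; split=> [x|v]; first exact: differentiableM.
rewrite (_ : (fun _ => _) = fun x => f x * 'D_v g x + g x * 'D_v f x).
  move=> x; apply: cvgD.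
  - exact: (cvgM (differentiable_continuous (fd x)) (gC v x)).
  - exact: (cvgM (differentiable_continuous (gd x)) (fC v x)).
by apply/funext => x; rewrite -deriveM //; exact: diff_derivable.
Qed.

Lemma class_C1_mx (m n : nat) (f : U -> 'M[R]_(m, n)) :
  (forall i j, class_C1 (fun x => f x i j)) -> class_C1 f.
Proof.
move=> fC; rewrite (_ : f = fun x => \sum_i \sum_j f x i j *: delta_mx i j).
  apply: class_C1_sum => i; apply: class_C1_sum => j.
  exact: class_C1Zl.
by apply/funext => x; exact: matrix_sum_delta.
Qed.

End ClassC1.

(** * Entrywise differentiation of matrix-valued maps *)

Lemma is_derive_entry (R : realType) (V : normedModType R) (m n : nat)
    (f : V -> 'M[R]_(m, n)) (t v : V) (d : 'M[R]_(m, n)) i j :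
  is_derive t v f d -> is_derive t v (fun s => f s i j) (d i j).
Proof.
move=> fd; apply: DeriveDef.
  by have /derivable_mxP : derivable f t v by exact: ex_derive.
have <- : 'D_v f t = d by exact: derive_val.
by rewrite derive_mx ?mxE //; exact: ex_derive.
Qed.

Lemma is_derive_mx (R : realType) (V : normedModType R) (m n : nat)
    (f : V -> 'M[R]_(m, n)) (t v : V) (d : 'M[R]_(m, n)) :
  (forall i j, is_derive t v (fun s => f s i j) (d i j)) -> is_derive t v f d.
Proof.
move=> fd.
have fD : derivable f t v by apply/derivable_mxP => i j; exact: ex_derive.
apply: DeriveDef => //; rewrite derive_mx //.
by apply/matrixP => i j; rewrite mxE; exact: derive_val.
Qed.

Lemma class_C1_entry (R : realType) (m n : nat) i j :
  class_C1 (fun x : 'M[R]_(m, n) => x i j : R).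
Proof.
split=> [x|v]; first exact: differentiable_coord.
(* An entry is linear, so its derivative along [v] does not depend on the point. *)
rewrite (_ : (fun _ => _) = fun _ => v i j); first exact: cst_continuous.
apply/funext => x; apply: derive_val.
by apply: is_derive_entry; exact: is_derive_id.
Qed.

(** * Weighted sums of squares as storage functions *)

Section DiagonalForm.
Variables (R : realType) (n : nat) (w : 'I_n -> R).

Definition diag_form (x : 'cV[R]_n) : R := 2^-1 * \sum_i w i * x i 0 ^+ 2.

Lemma class_C1_diag_form : class_C1 diag_form.
Proof.
apply: class_C1M; first exact: class_C1_cst.
apply: class_C1_sum => i; apply: class_C1M; first exact: class_C1_cst.
by under eq_fun do rewrite expr2; apply: class_C1M; exact: class_C1_entry.
Qed.

Lemma is_derive_diag_form (x : R -> 'cV[R]_n) (t : R) (d : 'cV[R]_n) :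
  is_derive t 1 x d ->
  is_derive t 1 (diag_form \o x) (\sum_i w i * x t i 0 * d i 0).
Proof.
move=> xd.
have xdi i : is_derive t 1 (fun s => x s i 0) (d i 0) by exact: is_derive_entry.
(* Written with pointwise operations on functions, the form is differentiated by the [is_derive]
   instances. *)
rewrite (_ : _ \o _ = 2^-1 \*: \sum_i (w i \*: (fun s => x s i 0) ^+ 2)).
  apply: is_derive_eq.
  rewrite scaler_sumr; apply: eq_bigr => i _.
  by rewrite /GRing.scale /= expr1; field.
apply/funext => s; rewrite /diag_form /= /GRing.scale /=; congr (_ * _).
by rewrite fct_sumE.
Qed.

Hypothesis w_gt0 : forall i, 0 < w i.

Lemma diag_form_ge0 x : 0 <= diag_form x.
Proof.
rewrite mulr_ge0 // sumr_ge0 // => i _.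
by rewrite mulr_ge0 ?sqr_ge0 // ltW.
Qed.

Lemma positive_definite_diag_form : positive_definite diag_form.
Proof.
split=> [|x x0].
  by rewrite /diag_form big1 ?mulr0 // => i _; rewrite mxE expr0n mulr0.
rewrite lt_def diag_form_ge0 andbT; apply: contra x0.
(* A vanishing sum of nonnegative terms has only zero terms; as the weights are positive, every
   coordinate is then 0. *)
rewrite mulf_eq0 invr_eq0 pnatr_eq0 /= psumr_eq0 => [/allP x0|i _]; last first.
  by rewrite mulr_ge0 ?sqr_ge0 // ltW.
apply/eqP/matrixP => i j; rewrite ord1 mxE; apply/eqP.
by have := x0 i (mem_index_enum i); rewrite mulf_eq0 gt_eqF //= sqrf_eq0.
Qed.

End DiagonalForm.

(** * The quadrotor: storage function, output, vector field and dissipation *)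

Lemma diag_mx_formE (R : realType) (n : nat) (d : 'rV[R]_n) (x : 'cV[R]_n) :
  (x^T *m diag_mx d *m x) 0 0 = \sum_i d 0 i * x i 0 ^+ 2.
Proof.
rewrite mul_mx_diag mxE; apply: eq_bigr => i _.
by rewrite !mxE; ring.
Qed.

(** The model addresses coordinates as [inord k]; this form lets sums over ordinals unfold into
    those same terms. *)
Lemma big_ord_inord (R : nmodType) (n : nat) (F : 'I_n.+1 -> R) :
  \sum_i F i = \sum_(0 <= k < n.+1) F (inord k).
Proof. by rewrite big_mkord; apply: eq_bigr => i _; rewrite inord_val. Qed.

(** Angles sit at even indices and carry the gains; rates sit at odd indices and carry the
    inertias. *)
Definition storage_weight (R : realType) (q : quadrotor R) (i : 'I_6) : R :=
  nth 0 [:: kphi q; Jx q; ktheta q; Jy q; kpsi q; Jz q] i.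

Lemma quadrotor_storageE (R : realType) (q : quadrotor R) :
  quadrotor_storage q 0 = diag_form (storage_weight q).
Proof.
apply/funext => x; rewrite /quadrotor_storage /diag_form subr0 !diag_mx_formE.
rewrite !big_ord_inord unlock /= /storage_weight !mxE !inordK //=.
by ring.
Qed.

Lemma class_C1_attitude (R : realType) : class_C1 (@attitude R).
Proof.
apply: class_C1_mx => i j; under eq_fun do rewrite mxE.
by case: i => -[|[|[|//]]] ? /=; exact: class_C1_entry.
Qed.

(** The output only selects coordinates, so its derivative selects the same coordinates of [d]. *)
Lemma is_derive_attitude (R : realType) (x : R -> 'cV[R]_6) (t : R)
    (d : 'cV[R]_6) :
  is_derive t 1 x d -> is_derive t 1 (@attitude R \o x) (attitude d).
Proof.
move=> xd; apply: is_derive_mx => i j /=; rewrite mxE.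
under eq_fun do rewrite mxE.
by case: i => -[|[|[|//]]] ? /=; exact: is_derive_entry.
Qed.

(** Every component is a polynomial in the coordinates of state and input and in the value of [g],
    whose argument is affine in state, input and thrust. *)
Lemma locally_lipschitz_rotational_dynamics (R : realType) (q : quadrotor R)
    (g : 'cV[R]_4 -> R) (etad : 'cV[R]_3) :
  locally_lipschitz g ->
  locally_lipschitz (fun z : 'cV[R]_6 * 'cV[R]_3 * R =>
    rotational_dynamics q g etad z.1.1 z.1.2 z.2).
Proof.
move=> gL.
have xL i : locally_lipschitz (fun z : 'cV[R]_6 * 'cV[R]_3 * R => z.1.1 i 0).
  apply: locally_lipschitz_entry.
  apply: (lipschitz_locally_lipschitz (k := 1)) => // y z.
  by rewrite mul1r !prod_normE !le_max lexx.
have vL i : locally_lipschitz (fun z : 'cV[R]_6 * 'cV[R]_3 * R => z.1.2 i 0).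
  apply: locally_lipschitz_entry.
  apply: (lipschitz_locally_lipschitz (k := 1)) => // y z.
  by rewrite mul1r !prod_normE !le_max lexx orbT.
have wL : locally_lipschitz (fun z : 'cV[R]_6 * 'cV[R]_3 * R => z.2).
  apply: (lipschitz_locally_lipschitz (k := 1)) => // y z.
  by rewrite mul1r prod_normE le_max lexx orbT.
have cL (c : R) : locally_lipschitz (fun _ : 'cV[R]_6 * 'cV[R]_3 * R => c).
  exact: locally_lipschitz_cst.
have guL : locally_lipschitz (fun z : 'cV[R]_6 * 'cV[R]_3 * R =>
    g (quadrotor_input q etad z.1.1 z.1.2 z.2)).
  apply: locally_lipschitz_comp => //; apply: locally_lipschitz_mx => i j.
  (* The first row of the input is the thrust, the other three are the inner feedback law. *)
  rewrite -[i]splitK; case: (fintype.split i) => k /=.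
    rewrite (_ : (fun _ => _) = fun z => z.2) //.
    by apply/funext => z; rewrite col_mxEu mxE (ord1 k) (ord1 j) mulr1n.
  rewrite (_ : (fun _ => _) = fun z : 'cV[R]_6 * 'cV[R]_3 * R =>
      - vec3 (kphi q) (ktheta q) (kpsi q) k 0 *
      (attitude z.1.1 k 0 - etad k 0) + z.1.2 k 0).
    apply: locally_lipschitzD => //; apply: locally_lipschitzM => //.
    apply: locally_lipschitzB => //.
    apply: eq_locally_lipschitz => [z|]; first by rewrite mxE.
    by case: k => -[|[|[|//]]] ? /=; exact: xL.
  apply/funext => z.
  by rewrite col_mxEd mul_diag_mx (ord1 j) mulNr !mxE.
apply: locally_lipschitz_mx => i j.
apply: eq_locally_lipschitz => [z|]; first by rewrite mxE.
(* The search follows the syntax of each of the six components down to coordinates, constants and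
   the value of [g]. *)
case: i => -[|[|[|[|[|[|//]]]]]] ? /=; repeat first
  [ exact: xL | exact: vL | exact: guL | exact: cL | apply: locally_lipschitzB
  | apply: locally_lipschitzD | apply: locally_lipschitzM ].
Qed.

Theorem theorem2 (R : realType) (q : quadrotor R) (g : 'cV[R]_4 -> R)
    (Jx_gt0 : 0 < Jx q) (Jy_gt0 : 0 < Jy q) (Jz_gt0 : 0 < Jz q)
    (kphi_gt0 : 0 < kphi q) (ktheta_gt0 : 0 < ktheta q) (kpsi_gt0 : 0 < kpsi q)
    (arm_unit : arm q = 1) (g_lipschitz : locally_lipschitz g)
    (etad : 'cV[R]_3) (etad_eq0 : etad = 0) :
  [/\ nonlinear_negative_imaginary (rotational_dynamics q g etad) (@attitude R),
      storage_function (rotational_dynamics q g etad) (@attitude R)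
        (quadrotor_storage q etad)
    & positive_definite (quadrotor_storage q etad)].
Proof.
rewrite {}etad_eq0 quadrotor_storageE.
have w_gt0 i : 0 < storage_weight q i.
  by case: i => -[|[|[|[|[|[|//]]]]]].
have storage : storage_function (rotational_dynamics q g 0) (@attitude R)
    (diag_form (storage_weight q)).
  split=> [|x|x u w xE t t0]; first exact: class_C1_diag_form.
    exact: diag_form_ge0.
  have xd := xE t t0.
  have Vd := is_derive_diag_form (storage_weight q) xd.
  have hd := is_derive_attitude xd.
  (* Both derivatives are read off [Vd] and [hd], and the equality case of the inequality is
     selected. *)
  rewrite !derive1E !derive_val mxE le_eqVlt; apply/orP; left; apply/eqP.
  rewrite !big_ord_inord unlock /= /storage_weight !mxE !inordK //=.
  (* With unit arm, [b1] and [b2] are the inverses of [Jx q] and [Jy q], so the inertias cancel in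
     front of gains and inputs; [field] only has to know that the inertias are nonzero. *)
  rewrite /a1 /a2 /a3 /a4 /a5 /b1 /b2 /b3 arm_unit.
  by field; rewrite !gt_eqF.
split=> //; last exact: positive_definite_diag_form.
split; [exact: locally_lipschitz_rotational_dynamics|exact: class_C1_attitude|].
by exists (diag_form (storage_weight q)).
Qed.
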